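(* Let $\alpha>-1$, $\beta>-1$, $n\ge1$ an integer. The Fourier transform of $\lambda\mapsto D_n(-{\rm i}\lambda,\alpha,\beta)$, $$\mathbb{P}(c,\alpha,\beta,n)=\frac{1}{2\pi D_n(0,\alpha,\beta)}\int_{-\infty}^{\infty}e^{-{\rm i}c\lambda}D_n(-{\rm i}\lambda,\alpha,\beta)\,d\lambda$$ (understood in the sense of distributions in $c$), is supported in the interval $[0,n]$.
   Context: For complex $\lambda$, $D_n(\lambda,\alpha,\beta)=\det\left(\int_0^1x^{j+k}x^{\alpha}(1-x)^{\beta}e^{-\lambda x}\,dx\right)_{j,k=0}^{n-1}=\frac1{n!}\int_{[0,1]^n}\prod_{1\le j<k\le n}(x_k-x_j)^2\prod_{l=1}^nx_l^{\alpha}(1-x_l)^{\beta}e^{-\lambda x_l}\,dx_l$, an entire function of $\lambda$. ${\rm i}$ is the imaginary unit. $\mathbb{P}(c,\alpha,\beta,n)$ is the probability density of $c=x_1+\dots+x_n$ for the Jacobi unitary ensemble with weight $x^\alpha(1-x)^\beta$ on $[0,1]$. *)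

(* Defs.v *)
From HB Require Import structures.
From mathcomp Require Import all_boot all_order all_algebra.
From mathcomp Require Import all_classical all_reals all_analysis.
From mathcomp Require Import complex.

Set Implicit Arguments.
Unset Strict Implicit.
Unset Printing Implicit Defensive.

Import Order.TTheory GRing.Theory Num.Theory.
Import numFieldNormedType.Exports.

Local Open Scope classical_set_scope.
Local Open Scope ring_scope.
Local Open Scope complex_scope.

Section ComplexAnalysis.
Variable R : realType.

Definition cexp (z : R[i]) : R[i] :=
  (expR (complex.Re z))%:C * (cos (complex.Im z) +i* sin (complex.Im z)).

Definition cintegral (D : set R) (f : R -> R[i]) : R[i] :=
  (\int[@lebesgue_measure R]_(x in D) complex.Re (f x)) +i*
  (\int[@lebesgue_measure R]_(x in D) complex.Im (f x)).

Definition smooth (phi : R -> R[i]) : Prop :=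
  forall (k : nat) (x : R),
    derivable (derive1n k (@complex.Re R \o phi)) x 1 /\
    derivable (derive1n k (@complex.Im R \o phi)) x 1.

Definition cderiven (k : nat) (phi : R -> R[i]) (x : R) : R[i] :=
  derive1n k (@complex.Re R \o phi) x +i* derive1n k (@complex.Im R \o phi) x.

Definition csupport (phi : R -> R[i]) : set R := closure [set x | phi x != 0].

End ComplexAnalysis.

(* Complex-valued distributions on the line. A distribution is represented by a
   functional on all functions R -> R[i]; only its values on test functions are
   ever constrained or used. *)
Section Distributions.
Variable R : realType.
Implicit Types (T : (R -> R[i]) -> R[i]) (A : set R) (phi psi : R -> R[i]).

(* phi is smooth with compact support contained in A *)
Definition test_function A phi : Prop :=
  [/\ smooth phi, compact (csupport phi) & csupport phi `<=` A].

(* Continuity is the usual seminorm estimate: for each compact K, |T phi| is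
   at most C times the maximum over k <= N of the sup-norms of phi^(k), for all
   phi supported in K; M below ranges over the upper bounds of that maximum. *)
Definition is_distribution T : Prop :=
  (forall (a : R[i]) phi psi,
     test_function setT phi -> test_function setT psi ->
     T (fun x => a * phi x + psi x) = a * T phi + T psi) /\
  (forall K : set R, compact K -> exists (C : R) (N : nat),
     forall phi (M : R), test_function K phi ->
       (forall (k : nat) (x : R), (k <= N)%N -> `|cderiven k phi x| <= M%:C) ->
       `|T phi| <= (C * M)%:C).

Definition vanishes_on T (U : set R) : Prop :=
  forall phi, test_function U phi -> T phi = 0.

(* complement of the union of the open sets on which T vanishes *)
Definition dsupport T : set R :=
  ~` \bigcup_(U in [set U : set R | open U /\ vanishes_on T U]) U.

Definition fourier phi (l : R) : R[i] :=
  cintegral setT (fun c => cexp (- 'i%C * c%:C * l%:C) * phi c).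

(* The distribution "c |-> \int e^(-i c l) f l dl": integrating against phi c
   and integrating in c first gives the pairing of f with fourier phi. *)
Definition fourier_distribution (f : R -> R[i]) phi : R[i] :=
  cintegral setT (fun l => f l * fourier phi l).

End Distributions.

Section JacobiHankel.
Variable R : realType.

Definition Dn (n : nat) (lambda : R[i]) (alpha beta : R) : R[i] :=
  \det (\matrix_(j < n, k < n)
    cintegral `[0, 1]%classic (fun x : R =>
      (x ^+ (j + k) * x `^ alpha * (1 - x) `^ beta)%:C *
      cexp (- lambda * x%:C))).

Definition jacobiP (alpha beta : R) (n : nat) (phi : R -> R[i]) : R[i] :=
  (2 * (pi : R)%:C * Dn n 0 alpha beta)^-1 *
  fourier_distribution (fun l : R => Dn n (- 'i%C * l%:C) alpha beta) phi.

End JacobiHankel.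

(* Main.v *)
(* For a test function phi write phi^ for its Fourier transform, so that the
   distribution pairs phi with the integral of f(l) phi^(l), where f(l) is the
   determinant of the functions h_{j+k}(l) = int_0^1 w_{j+k}(x) e^{ilx} dx.
   Integrating by parts twice, phi^(l) = O(1/(1+l^2)), and f is bounded: this
   gives the continuity estimate with two derivatives.  For the support, expand
   the determinant and prove by induction on m that
     int e^{iyl} h_1(l) ... h_m(l) phi^(l) dl = 0
   whenever phi vanishes near each point of [y, y+m]: by Fubini one factor h
   turns into an average over y' in [y, y+1] of the statement for m-1.
   For m = 0, write phi(c) = sin(h(c-y)) g(c) with g a test function, which is
   possible because phi vanishes near y and h may be taken small; then
   e^{iyl} phi^(l) is a multiple of G(l+h) - G(l-h) with G(l) = e^{iyl} g^(l)
   integrable, and translation invariance of Lebesgue measure concludes. *)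
Require Import Defs.
From HB Require Import structures.
From mathcomp Require Import all_boot all_order all_algebra.
From mathcomp Require Import all_classical all_reals all_analysis.
From mathcomp Require Import perm measurable_realfun complex.
From mathcomp Require Import ring lra.

Set Implicit Arguments.
Unset Strict Implicit.
Unset Printing Implicit Defensive.

Import Order.TTheory GRing.Theory Num.Theory.
Import numFieldNormedType.Exports.

Local Open Scope classical_set_scope.
Local Open Scope ring_scope.

(** * Lebesgue measure and the Jacobi weight *)

Section MeasureAndWeight.
Context {R : realType}.
Local Notation mu := (@lebesgue_measure R).
Implicit Types (f g u : R -> R) (a b h x y : R).

(** Lebesgue measure is determined by its values on half-open intervals, and its pushforward under
    the shift has the same values there. *)
Lemma lebesgue_measure_shift h (A : set R) : measurable A ->
  mu ((fun x => x + h) @^-1` A) = mu A.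
Proof.
move=> mA.
have mh : measurable_fun [set: measurableTypeR R]
    (fun x : measurableTypeR R => (x : R) + h : measurableTypeR R).
  by apply: continuous_measurable_fun => z; apply: cvgD; [exact: cvg_id|exact: cvg_cst].
pose phi : {mfun measurableTypeR R >-> measurableTypeR R} :=
  HB.pack (fun x : measurableTypeR R => (x : R) + h : measurableTypeR R)
    (isMeasurableFun.Build _ _ _ _ _ mh).
apply/esym; apply: (@lebesgue_measure_unique _ (pushforward mu phi)) => //.
move=> X [[a b] _ <-].
transitivity (mu `](a - h), (b - h)]%classic).
  rewrite !lebesgue_measure_itv/= !lte_fin ltrD2r.
  by case: ifP => // _; rewrite -!EFinD; congr (_%:E); ring.
rewrite /pushforward; congr (mu _).
by apply/seteqP; split => x /=; rewrite !in_itv/= ltrBlDr lerBrDr.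
Qed.

(** The same uniqueness argument: the preimage of []a, b]] is half-open on the other side, which
    leaves its length unchanged. *)
Lemma lebesgue_measure_reflect h (A : set R) : measurable A ->
  mu ((fun x => h - x) @^-1` A) = mu A.
Proof.
move=> mA.
have mh : measurable_fun [set: measurableTypeR R]
    (fun x : measurableTypeR R => h - (x : R) : measurableTypeR R).
  by apply: continuous_measurable_fun => z; apply: cvgB; [exact: cvg_cst|exact: cvg_id].
pose phi : {mfun measurableTypeR R >-> measurableTypeR R} :=
  HB.pack (fun x : measurableTypeR R => h - (x : R) : measurableTypeR R)
    (isMeasurableFun.Build _ _ _ _ _ mh).
apply/esym; apply: (@lebesgue_measure_unique _ (pushforward mu phi)) => //.
move=> X [[a b] _ <-].
transitivity (mu `[(h - b), (h - a)[%classic).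
  rewrite !lebesgue_measure_itv/= !lte_fin ltrD2l ltrN2.
  by case: ifP => // _; rewrite -!EFinD; congr (_%:E); ring.
rewrite /pushforward; congr (mu _).
by apply/seteqP; split => x /=; rewrite !in_itv/= => /andP[? ?]; apply/andP; split; lra.
Qed.

Lemma ge0_integral_preserving (phi : R -> R) (f : R -> \bar R) :
  measurable_fun setT phi ->
  (forall A, measurable A -> mu (phi @^-1` A) = mu A) ->
  measurable_fun setT f -> (forall x, 0 <= f x)%E ->
  (\int[mu]_x f (phi x) = \int[mu]_x f x)%E.
Proof.
move=> mphi pphi mf f0.
have mphi' : measurable_fun [set: measurableTypeR R]
  (phi : measurableTypeR R -> measurableTypeR R) by exact: mphi.
have := ge0_integral_pushforward mphi' mu measurableT mf (fun y _ => f0 y).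
rewrite preimage_setT => <-.
by apply: eq_measure_integral => A mA _; exact: pphi.
Qed.

Lemma integral_shift (f : R -> \bar R) h : measurable_fun setT f ->
  (forall x, 0 <= f x)%E ->
  (\int[mu]_x f (x + h)%R = \int[mu]_x f x)%E.
Proof.
apply: ge0_integral_preserving; last by move=> A; exact: lebesgue_measure_shift.
by apply: continuous_measurable_fun => z; apply: cvgD; [exact: cvg_id|exact: cvg_cst].
Qed.

Lemma integral_reflect (f : R -> \bar R) h : measurable_fun setT f ->
  (forall x, 0 <= f x)%E ->
  (\int[mu]_x f (h - x)%R = \int[mu]_x f x)%E.
Proof.
apply: ge0_integral_preserving; last by move=> A; exact: lebesgue_measure_reflect.
by apply: continuous_measurable_fun => z; apply: cvgB; [exact: cvg_cst|exact: cvg_id].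
Qed.

Lemma integrable_shift f h : mu.-integrable setT (EFin \o f) ->
  mu.-integrable setT (EFin \o (fun x => f (x + h))).
Proof.
move=> /integrableP[mf foo]; apply/integrableP; split.
  apply: (measurableT_comp mf) => //.
  by apply: continuous_measurable_fun => z; apply: cvgD; [exact: cvg_id|exact: cvg_cst].
rewrite (@integral_shift (fun x => `|(f x)%:E|)%E)//.
exact: measurableT_comp.
Qed.

Lemma Rintegral_shift f h : mu.-integrable setT (EFin \o f) ->
  \int[mu]_x f (x + h) = \int[mu]_x f x.
Proof.
move=> fi; have fhi := integrable_shift h fi.
have mf := measurable_int _ fi.
rewrite /Rintegral; congr fine.
rewrite integralE [RHS]integralE; congr (_ - _)%E.
  (* Positive and negative parts are locked definitions; once unfolded, they visibly commute with
     the shift. *)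
  transitivity (\int[mu]_x (EFin \o f)^\+%E (x + h)%R)%E.
    by rewrite !unlock.
  by rewrite integral_shift//; exact: measurable_funepos.
transitivity (\int[mu]_x (EFin \o f)^\-%E (x + h)%R)%E.
  by rewrite !unlock.
by rewrite integral_shift//; exact: measurable_funeneg.
Qed.

(** The intervals [[1/(n+1), 1]] exhaust []0, 1]]; on each of them the primitive [x^(a+1) / (a+1)]
    bounds the integral by [1/(a+1)], and monotone convergence concludes. *)
Lemma integrable_powR a : -1 < a ->
  mu.-integrable `]0, 1] (EFin \o (fun x => x `^ a)).
Proof.
move=> a1; have ap : 0 < a + 1 by rewrite -ltrBlDr sub0r.
have mp D : measurable_fun D (fun x : R => x `^ a).
  by apply: measurable_funTS; exact: measurable_powR.
apply/integrableP; split; first by apply/measurable_EFinP; exact: mp.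
pose F (n : nat) : set R := `[n.+1%:R^-1, 1]%classic.
have FU : \bigcup_n F n = `]0, 1]%classic.
  apply/seteqP; split => x /=.
    move=> [n _]; rewrite /F/= !in_itv/= => /andP[nx ->]; rewrite andbT.
    by rewrite (lt_le_trans _ nx).
  rewrite !in_itv/= => /andP[x0 x1].
  have [n nx] := ltr_add_invr x0.
  exists n => //; rewrite /F/= in_itv/= x1 andbT.
  by rewrite -[leLHS]add0r ltW.
rewrite -FU.
have nF : nondecreasing_seq F.
  apply/nondecreasing_seqP => n; apply/subsetPset => x.
  rewrite /F/= !in_itv/= => /andP[nx ->]; rewrite andbT.
  by rewrite (le_trans _ nx)// lef_pV2 ?posrE// ler_nat.
have Fbound n : (\int[mu]_(x in F n) `|(x `^ a)%:E| <= (a + 1)^-1%:E)%E.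
  have n0 : 0 < n.+1%:R^-1 :> R by rewrite invr_gt0.
  (* For [n = 0] the interval is the point 1 alone, and the fundamental theorem of calculus is
     applied only to proper intervals. *)
  have [n1|n1] := eqVneq (n.+1%:R^-1 : R) 1.
    by rewrite /F n1 set_itv1 integral_set1 lee_fin invr_ge0 ltW.
  have {}n1 : n.+1%:R^-1 < 1 :> R by rewrite lt_neqAle n1 invf_le1// ler1n.
  have dF x : 0 < x -> is_derive x 1 (fun x => (a + 1)^-1 * x `^ (a + 1)) (x `^ a).
    move=> x0; have := is_derive1_powR (a + 1) x0.
    rewrite addrK => d.
    have := @is_deriveZ _ _ _ (fun x => x `^ (a + 1)) ((a + 1)^-1) _ _ _ d.
    rewrite /GRing.scale/= mulrA mulVf ?mul1r//; exact: lt0r_neq0.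
  under eq_integral do rewrite gee0_abs ?lee_fin ?powR_ge0//.
  have cF x : 0 < x -> {for x, continuous (fun x => (a + 1)^-1 * x `^ (a + 1))}.
    move=> x0; apply/differentiable_continuous/derivable1_diffP.
    by have := dF _ x0; move=> /@ex_derive.
  rewrite (@continuous_FTC2 _ _ (fun x => (a + 1)^-1 * x `^ (a + 1)))//.
  - rewrite powR1 mulr1 -EFinB lee_fin gerBl mulr_ge0 ?powR_ge0// invr_ge0 ltW//.
  - apply: derivable_within_continuous => x; rewrite in_itv/= => /andP[nx _].
    by apply: derivable_powR; rewrite in_itv/= (lt_le_trans n0).
  - split.
    + move=> x; rewrite in_itv/= => /andP[nx _].
      by have := dF _ (lt_trans n0 nx); move=> /@ex_derive.
    + by apply: cvg_at_right_filter; exact: cF.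
    + by apply: cvg_at_left_filter; exact: cF.
  - move=> x; rewrite in_itv/= => /andP[nx _].
    by rewrite derive1E; have := dF _ (lt_trans n0 nx); move=> /@derive_val.
have mF n : measurable (F n : set (measurableTypeR R)) by exact: measurable_itv.
have mpF n : measurable_fun (F n : set (measurableTypeR R)) (fun x : R => `|(x `^ a)%:E|%E).
  by apply: measurableT_comp => //; apply: measurableT_comp => //; exact: mp.
have := @ge0_nondecreasing_set_cvg_integral _ (measurableTypeR R) R F
  (fun x : R => `|(x `^ a)%:E|%E) mu nF mF mpF (fun _ _ _ => abse_ge0 _).
move=> /cvg_lim <-//.
apply: (@le_lt_trans _ _ ((a + 1)^-1)%:E); last exact: ltry.
apply: lime_le; last exact: nearW.
apply: ereal_nondecreasing_is_cvgn.
by apply: ge0_nondecreasing_set_nondecreasing_integral.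
Qed.

(** The reflection [x |-> 1 - x] carries this to [integrable_powR]. *)
Lemma integrable_powR_onem a : -1 < a ->
  mu.-integrable `[0, 1[ (EFin \o (fun x => (1 - x) `^ a)).
Proof.
move=> a1; have /integrableP[_ ioo] := integrable_powR a1.
have mp : measurable_fun setT (fun x : R => x `^ a) by exact: measurable_powR.
apply/integrableP; split.
  apply/measurable_EFinP/measurable_funTS; apply: (measurableT_comp mp) => //.
  by apply: continuous_measurable_fun => z; apply: cvgB; [exact: cvg_cst|exact: cvg_id].
apply: le_lt_trans ioo.
rewrite integral_mkcond [leRHS]integral_mkcond -(integral_reflect 1).
- rewrite le_eqVlt; apply/orP; left; apply/eqP; apply: eq_integral => x _.
  rewrite !patchE !mem_setE !in_itv/=.
  have -> : (0 <= 1 - x < 1) = (0 < (x : R) <= 1).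
    by apply/idP/idP => /andP[? ?]; apply/andP; split; lra.
  by rewrite opprB addrC subrK.
- apply/(measurable_restrictT _ _).1 => //; apply: measurableT_comp => //.
  apply/measurable_EFinP/measurable_funTS; apply: (measurableT_comp mp) => //.
  by apply: continuous_measurable_fun => z; apply: cvgB; [exact: cvg_cst|exact: cvg_id].
- by move=> x; apply: erestrict_ge0 => y _; exact: abse_ge0.
Qed.

(** The maximum is 1 when [a >= 0] and [(1/2)^a] when [a < 0]; the sum of the two serves both
    signs. *)
Lemma powR_half_le1 a x : 2^-1 <= x <= 1 -> x `^ a <= 1 + 2^-1 `^ a.
Proof.
move=> /andP[x2 x1]; have x0 : 0 < x by lra.
have [a0|a0] := leP 0 a.
  apply: (@le_trans _ _ 1); last by rewrite lerDl powR_ge0.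
  by rewrite -(powRr0 x); apply: ger_powR => //; rewrite x0.
apply: (@le_trans _ _ (2^-1 `^ a)); last by rewrite lerDr ler01.
rewrite -[a]opprK !(powRN _ (- a)) lef_pV2 ?posrE ?powR_gt0//.
by apply: ge0_ler_powR => //; rewrite ?nnegrE; lra.
Qed.

(** Each half of the interval meets only one of the two possible singularities, and the other factor
    is bounded there; hence the majorant [C * (x^a + (1-x)^b)]. *)
Lemma integrable_jacobi_weight (m : nat) a b : -1 < a -> -1 < b ->
  mu.-integrable `[0, 1] (EFin \o (fun x => x ^+ m * x `^ a * (1 - x) `^ b)).
Proof.
move=> a1 b1.
have mw : measurable_fun setT (fun x : R => x ^+ m * x `^ a * (1 - x) `^ b).
  apply: measurable_funM; last first.
    apply: (measurableT_comp (measurable_powR b)) => //.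
    by apply: continuous_measurable_fun => z; apply: cvgB; [exact: cvg_cst|exact: cvg_id].
  apply: measurable_funM; last exact: measurable_powR.
  by apply: continuous_measurable_fun => z; exact: exprn_continuous.
(* The endpoints are null, and on the open interval both one-sided power lemmas are available. *)
suff /integrableP[_ ioo] : mu.-integrable `]0, 1[
    (EFin \o (fun x => x ^+ m * x `^ a * (1 - x) `^ b)).
  apply/integrableP; split; first by apply/measurable_EFinP; exact: measurable_funTS.
  rewrite -integral_itv_obnd_cbnd; last first.
    by apply: measurable_funTS; do 2 apply: measurableT_comp => //.
  rewrite -integral_itv_bndo_bndc//.
  by apply: measurable_funTS; do 2 apply: measurableT_comp => //.
have ia : mu.-integrable `]0, 1[ (EFin \o (fun x => x `^ a)).
  apply: integrableS (integrable_powR a1) => //.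
  by apply: subset_itvl; rewrite bnd_simp.
have ib : mu.-integrable `]0, 1[ (EFin \o (fun x => (1 - x) `^ b)).
  apply: integrableS (integrable_powR_onem b1) => //.
  by apply: subset_itvr; rewrite bnd_simp.
pose C : R := 1 + 2^-1 `^ a + 2^-1 `^ b.
have C0 : 0 <= C by rewrite /C !addr_ge0 ?powR_ge0.
have mI : measurable (`]0, 1[%classic : set (measurableTypeR R)).
  exact: measurable_itv.
have := integrableZl mI C (integrableD mI ia ib).
apply: le_integrable => //; first by apply/measurable_EFinP; exact: measurable_funTS.
move=> x; rewrite /= in_itv/= => /andP[x0 x1].
rewrite lee_fin !ger0_norm; last 2 first.
- by rewrite !mulr_ge0 ?addr_ge0 ?powR_ge0.
- by rewrite !mulr_ge0 ?powR_ge0// exprn_ge0// ltW.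
apply: (@le_trans _ _ (x `^ a * (1 - x) `^ b)).
  rewrite ler_wpM2r ?powR_ge0// ler_piMl ?powR_ge0//.
  by rewrite exprn_ile1// ltW.
have pa := powR_ge0 x a; have pb := powR_ge0 (1 - x) b.
have qa := powR_ge0 (2^-1 : R) a; have qb := powR_ge0 (2^-1 : R) b.
have [x2|x2] := leP x 2^-1.
  have h : (1 - x) `^ b <= C.
    apply: (le_trans (powR_half_le1 b _)); first by apply/andP; split; lra.
    by rewrite /C; lra.
  rewrite mulrC mulrDr; apply: (@le_trans _ _ (C * x `^ a)).
    by rewrite ler_wpM2r.
  by rewrite lerDl mulr_ge0.
have h : x `^ a <= C.
  apply: (le_trans (powR_half_le1 a _)); first by apply/andP; split; lra.
  by rewrite /C; lra.
rewrite mulrDr; apply: (@le_trans _ _ (C * (1 - x) `^ b)).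
  by rewrite ler_wpM2r.
by rewrite lerDr mulr_ge0.
Qed.

End MeasureAndWeight.

(** * Integrals of compactly supported functions, and Fubini for kernels [k (l * x)] *)

Section Integration.
Context {R : realType}.
Local Notation mu := (@lebesgue_measure R).
Implicit Types (f g u k p w : R -> R) (A M l h x y : R).

(** Evenness reduces this to the arctangent integral on the half-line. Up to constants, this
    function dominates the transforms of all functions in [C2c]. *)
Lemma integrable_oneDsqrV : mu.-integrable setT (fun l => (oneDsqr l)^-1%:E).
Proof.
apply/integrableP; split.
  apply/measurable_EFinP; apply: continuous_measurable_fun.
  exact: continuous_oneDsqrV.
under eq_integral do rewrite gee0_abs ?lee_fin ?invr_ge0 ?addr_ge0 ?sqr_ge0//.
rewrite ge0_symfun_integralT.
- have := @integral0y_oneDsqr R; rewrite set_itvcy => ->.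
  by rewrite -EFinM ltry.
- by move=> x; rewrite invr_ge0 addr_ge0 ?sqr_ge0.
- exact: continuous_oneDsqrV.
- by move=> x; rewrite /= /oneDsqr sqrrN.
Qed.

Lemma integrable_bndM k f B : measurable_fun setT k ->
  (forall x, `|k x| <= B) -> mu.-integrable setT (EFin \o f) ->
  mu.-integrable setT (EFin \o (fun x => k x * f x)).
Proof.
move=> mk kB fi.
have := @integrableMr _ _ R mu _ measurableT k _ mk _ fi; apply.
exists B; split; first exact: num_real.
by move=> C BC x _; apply: (le_trans (kB x)); exact: ltW.
Qed.

Section CompactSupport.
Variables (A : R) (u : R -> R).
Hypotheses (cu : continuous u) (u0 : forall x, A < `|x| -> u x = 0).

Lemma cpt_restrict : u \_ `[- A, A] = u.
Proof.
apply/funext => x; rewrite patchE mem_setE in_itv/= -ler_norml.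
by case: leP => // /u0.
Qed.

Lemma integrable_cpt : mu.-integrable setT (EFin \o u).
Proof.
rewrite -cpt_restrict -restrict_EFin.
have mI : measurable (`[- A, A]%classic : set (measurableTypeR R)).
  exact: measurable_itv.
apply/(integrable_mkcond _ mI).
apply: continuous_compact_integrable; first exact: segment_compact.
exact: continuous_subspaceT.
Qed.

Lemma Rintegral_cpt : \int[mu]_x u x = \int[mu]_(x in `[- A, A]) u x.
Proof.
transitivity (\int[mu]_x ((u \_ `[- A, A]) x)); first by rewrite cpt_restrict.
by rewrite [RHS]Rintegral_mkcond.
Qed.

Lemma Rintegral_cpt_le M : 0 <= A -> (forall x, `|u x| <= M) ->
  `|\int[mu]_x u x| <= 2 * A * M.
Proof.
move=> A0 uM; rewrite Rintegral_cpt.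
have mI : measurable (`[- A, A]%classic : set (measurableTypeR R)).
  exact: measurable_itv.
have ui : mu.-integrable `[- A, A] (EFin \o u).
  exact: integrableS integrable_cpt.
have muI : mu `[- A, A]%classic = (2 * A)%:E.
  (* In the second case [A = 0]: the length formula takes its degenerate branch, and both sides are
     0. *)
  rewrite lebesgue_measure_itv/= lte_fin; case: ltP => AA.
    by rewrite -EFinD; congr (_%:E); lra.
  by congr (_%:E); lra.
apply: (le_trans (le_normr_Rintegral mI ui)).
have -> : 2 * A * M = \int[mu]_(x in `[- A, A]) (cst M x).
  by rewrite Rintegral_cst// mulrC; congr (_ * _); exact: (congr1 fine (esym muI)).
apply: le_Rintegral => //.
- exact: integrable_norm.
- apply: continuous_compact_integrable; first exact: segment_compact.
  by apply: continuous_subspaceT => x; exact: cvg_cst.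
Qed.

End CompactSupport.

Lemma Rintegral_derive_eq0 A (F f : R -> R) : 0 < A -> continuous f ->
  (forall x, is_derive x 1 F (f x)) -> (forall x, A < `|x| -> F x = 0) ->
  (forall x, A < `|x| -> f x = 0) ->
  \int[mu]_x f x = 0.
Proof.
move=> A0 cf dF F0 f0.
(* Vanishing is known only for [|x| > A], so the interval is enlarged to [A + 1], where [F] is 0 at
   both endpoints. *)
have f1 x : A + 1 < `|x| -> f x = 0 by move=> ?; apply: f0; lra.
rewrite (@Rintegral_cpt (A + 1))// /Rintegral.
have cF : continuous F.
  move=> x; apply/differentiable_continuous/derivable1_diffP.
  by have := dF x; move=> /@ex_derive.
rewrite (@continuous_FTC2 _ _ F).
- have FA : F (A + 1) = 0 by apply: F0; rewrite ger0_norm; lra.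
  have FNA : F (- (A + 1)) = 0 by apply: F0; rewrite normrN ger0_norm; lra.
  by rewrite FA FNA sube0.
- by lra.
- exact: continuous_subspaceT.
- split.
  + by move=> x _; have := dF x; move=> /@ex_derive.
  + by apply: cvg_at_right_filter; exact: cF.
  + by apply: cvg_at_left_filter; exact: cF.
- by move=> x _; rewrite derive1E; have := dF x; move=> /@derive_val.
Qed.

(** The integrand is dominated by [B * |w x| * |p l|], so it is integrable on the product and the
    order of integration may be exchanged. *)
Lemma RfubiniT w k p B :
  mu.-integrable setT (EFin \o w) -> mu.-integrable setT (EFin \o p) ->
  continuous k -> (forall x, `|k x| <= B) ->
  \int[mu]_l ((\int[mu]_x (w x * k (l * x))) * p l) =
  \int[mu]_x (w x * \int[mu]_l (k (l * x) * p l)).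
Proof.
move=> wi pi ck kB.
have mw : measurable_fun setT w by apply/measurable_EFinP; exact: (measurable_int mu).
have mp : measurable_fun setT p by apply/measurable_EFinP; exact: (measurable_int mu).
have mk : measurable_fun setT k by exact: continuous_measurable_fun.
have mkl l : measurable_fun setT (fun x => k (l * x)).
  by apply: measurableT_comp => //; exact: measurable_funM.
have mkr l : measurable_fun setT (fun x => k (x * l)).
  by apply: measurableT_comp => //; exact: measurable_funM.
pose f (z : measurableTypeR R * measurableTypeR R) : \bar R :=
  (w z.1 * (k (z.2 * z.1) * p z.2))%:E.
have mf : measurable_fun setT f.
  apply/measurable_EFinP; apply: measurable_funM; first exact: measurableT_comp.
  apply: measurable_funM; last exact: measurableT_comp.
  by apply: measurableT_comp => //; exact: measurable_funM.
have kpi x : mu.-integrable setT (EFin \o (fun l => k (l * x) * p l)).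
  exact: (@integrable_bndM _ _ B).
have wki l : mu.-integrable setT (EFin \o (fun x => w x * k (l * x))).
  have := @integrable_bndM _ _ B (mkl l) (fun x => kB _) wi.
  by apply: eq_integrable => // x _; rewrite /= mulrC.
have fi : (mu \x mu)%E.-integrable setT f.
  apply/integrable12ltyP => //.
  have B0 : 0 <= B by rewrite (le_trans _ (kB 0)).
  have Ip : (\int[mu]_l `|(p l)%:E| \is a fin_num)%E.
    by have /integrableP[_ ?] := pi; rewrite ge0_fin_numE// integral_ge0.
  have mabs g : measurable_fun setT g -> measurable_fun setT (fun x : R => `|(g x)%:E|%E).
    by move=> mg; do 2 apply: measurableT_comp => //.
  apply: (@le_lt_trans _ _ (\int[mu]_x
      ((B * fine (\int[mu]_l `|(p l)%:E|))%:E * `|(w x)%:E|))%E).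
    apply: ge0_le_integral => //.
    - by move=> x _; exact: integral_ge0.
    - apply: (measurable_fun_fubini_tonelli_F (abse \o f)) => //=.
      exact: measurableT_comp.
    - by apply: emeasurable_funM => //; exact: mabs.
    - move=> x _; rewrite EFinM fineK// muleAC -ge0_integralZl//; last 2 first.
      + exact: mabs.
      + by rewrite mule_ge0// lee_fin.
      apply: ge0_le_integral => //.
      + apply: mabs => /=; apply: measurable_funM => //; apply: measurable_funM => //; exact: mkr.
      + by apply: emeasurable_funM => //; exact: mabs.
      + move=> l _; rewrite -!EFinM lee_fin !normrM mulrA ler_wpM2r// mulrC.
        by rewrite ler_wpM2r.
  rewrite ge0_integralZl//; last 2 first.
  - exact: mabs.
  - by rewrite lee_fin mulr_ge0// fine_ge0// integral_ge0.
  by have /integrableP[_ ?] := wi; rewrite lte_mul_pinfty// ?lee_fin mulr_ge0// fine_ge0// integral_ge0.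
have fil l : mu.-integrable setT (EFin \o (fun x => w x * k (l * x) * p l)).
  have := @integrable_bndM (cst (p l)) _ `|p l| (measurable_cst _) (fun=> lexx _) (wki l).
  by apply: eq_integrable => // x _; rewrite /= mulrC.
have fix_ x : mu.-integrable setT (EFin \o (fun l => w x * (k (l * x) * p l))).
  exact: (@integrable_bndM (cst (w x)) _ `|w x| (measurable_cst _) (fun=> lexx _) (kpi x)).
have := Fubini fi => /(congr1 fine) H.
(* The inner real integrals are [fine] of extended ones; integrability of each slice makes these
   finite, so nothing is lost. *)
transitivity (fine (\int[mu]_y \int[mu]_x f (x, y)))%E.
  congr fine; apply: eq_integral => l _.
  rewrite -RintegralZr// /Rintegral fineK.
    by apply: eq_integral => x _; rewrite /f/= mulrA.
  exact: (integrable_fin_num _ (fil l)).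
rewrite -H; congr fine; apply: eq_integral => x _.
rewrite -RintegralZl// /Rintegral fineK//.
exact: (integrable_fin_num _ (fix_ x)).
Qed.

Lemma Rfubini (D : set R) w k p B : measurable (D : set (measurableTypeR R)) ->
  mu.-integrable D (EFin \o w) ->
  mu.-integrable setT (EFin \o p) -> continuous k -> (forall x, `|k x| <= B) ->
  \int[mu]_l ((\int[mu]_(x in D) (w x * k (l * x))) * p l) =
  \int[mu]_(x in D) (w x * \int[mu]_l (k (l * x) * p l)).
Proof.
move=> mD wi pi ck kB.
have wi' : mu.-integrable setT (EFin \o (w \_ D)).
  by rewrite -restrict_EFin; apply/(integrable_mkcond _ mD).
have E g : \int[mu]_(x in D) (w x * g x) = \int[mu]_x ((w \_ D) x * g x).
  rewrite Rintegral_mkcond; apply: eq_Rintegral => x _.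
  by rewrite !patchE; case: ifP => // _; rewrite mul0r.
rewrite E -(RfubiniT wi' pi ck kB); apply: eq_Rintegral => l _.
by rewrite E.
Qed.
End Integration.

(** * Transforms of compactly supported functions *)

Section Transforms.
Context {R : realType}.
Local Notation mu := (@lebesgue_measure R).
Implicit Types (f g u k p w : R -> R) (A M l h x y : R).

(** Dominated convergence, with the majorant [B * |w|] independent of [l]. *)
Lemma continuous_transform (D : set R) w k B :
  measurable (D : set (measurableTypeR R)) ->
  mu.-integrable D (EFin \o w) -> continuous k -> (forall x, `|k x| <= B) ->
  continuous (fun l => \int[mu]_(x in D) (w x * k (l * x))).
Proof.
move=> mD wi ck kB l.
have B0 : 0 <= B by rewrite (le_trans _ (kB 0)).
have mw : measurable_fun D w by apply/measurable_EFinP; exact: (measurable_int mu).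
have mkl z : measurable_fun D (fun x => k (z * x)).
  apply: measurable_funTS; apply: measurableT_comp; last exact: measurable_funM.
  exact: continuous_measurable_fun.
have gi : mu.-integrable D (EFin \o (fun x => B * `|w x|)).
  exact: (integrableZl mD B (integrable_norm wi)).
have wki z : mu.-integrable D (EFin \o (fun x => w x * k (z * x))).
  apply: le_integrable gi => //.
    by apply/measurable_EFinP; apply: measurable_funM => //; exact: mkl.
  move=> x _; rewrite lee_fin !normrM normr_id (ger0_norm B0) mulrC.
  by rewrite ler_wpM2r.
have := @continuity_under_integral R _ _ mu (fun z x => w x * k (z * x)) D mD
  (l - 1) (l + 1) (fun z _ => wki z) _ _ gi.
move=> /(_ _ _ l); apply.
- apply: aeW => x _ z _ /=.
  apply: cvgM; first exact: cvg_cst.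
  apply: continuous_comp; last exact: ck.
  by apply: cvgM; [exact: cvg_id|exact: cvg_cst].
- move=> z _; apply: aeW => x _; rewrite normrM mulrC.
  by rewrite ler_wpM2r.
- by rewrite inE/= in_itv/=; lra.
Qed.

(** The equation [k'' = - k] and the bound 1 are what the decay estimate takes from cosine and sine,
    so that both components of the Fourier kernel are treated at once. *)
Definition oscillator k kd := [/\ forall x, is_derive x 1 k (kd x),
  forall x, is_derive x 1 kd (- k x) & forall x, `|k x| <= 1].

Lemma oscillator_cos : oscillator cos (fun x : R => - sin x).
Proof.
split=> x; first exact: is_derive_cos.
- by have := is_deriveN (is_derive_sin x).
- by rewrite ler_norml cos_geN1 cos_le1.
Qed.

Lemma oscillator_sin : oscillator sin (@cos R).
Proof.
split=> x; first exact: is_derive_sin.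
- exact: is_derive_cos.
- by rewrite ler_norml sin_geN1 sin_le1.
Qed.

Lemma is_derive_continuous f df : (forall x, is_derive x 1 f (df x)) ->
  continuous f.
Proof.
move=> fd x; apply/differentiable_continuous/derivable1_diffP.
by have := fd x; move=> /@ex_derive.
Qed.

Lemma is_derive_near0 f x df : (\forall z \near x, f z = 0) ->
  is_derive x 1 f df -> df = 0.
Proof.
move=> f0 fd.
have d0 : is_derive x 1 f 0.
  apply: (@near_eq_is_derive _ _ _ (cst 0) f) => //.
  by near=> z => /=; apply/esym; near: z.
by rewrite -(@derive_val _ _ _ _ _ _ _ fd) (@derive_val _ _ _ _ _ _ _ d0).
Unshelve. end_near. Qed.

(** Two derivatives give the transform a decay of order [1/(1 + l^2)], hence integrability. The
    class is also stable under the division by a sine carried out below, and explicit derivatives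
    keep that computation algebraic. *)
Definition C2c A u u1 u2 := [/\ continuous u2, forall x, is_derive x 1 u (u1 x),
  forall x, is_derive x 1 u1 (u2 x) & forall x, A < `|x| -> u x = 0].

Lemma near_norm_gt A x : A < `|x| -> \forall z \near x, A < `|z|.
Proof.
move=> Ax; have := @norm_continuous _ R^o x.
by move=> /cvgr_gt /(_ _ Ax).
Qed.

(** The region [A < |x|] is open, so vanishing of [u] there passes to its derivatives. *)
Lemma C2c_outside A u u1 u2 x : C2c A u u1 u2 -> A < `|x| ->
  [/\ u x = 0, u1 x = 0 & u2 x = 0].
Proof.
move=> [_ d1 d2 u0] Ax.
have u10 z : A < `|z| -> u1 z = 0.
  move=> Az; apply: is_derive_near0 (d1 z).
  by apply: filterS (near_norm_gt Az) => t /u0.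
split; [exact: u0|exact: u10|].
apply: is_derive_near0 (d2 x).
by apply: filterS (near_norm_gt Ax) => t /u10.
Qed.

(** Both integrations by parts are done at once, through a compactly supported primitive of
    [l^2 u k + u2 k]. *)
Lemma transform_by_parts A u u1 u2 k kd l : 0 < A -> C2c A u u1 u2 ->
  oscillator k kd ->
  l ^+ 2 * \int[mu]_x (u x * k (l * x)) = - \int[mu]_x (u2 x * k (l * x)).
Proof.
move=> A0 uc [dk dkd k1].
have [cu2 d1 d2 u0] := uc.
have cu := is_derive_continuous d1.
have ck : continuous k := is_derive_continuous dk.
have ckl : continuous (fun x => k (l * x)).
  move=> x; apply: continuous_comp; last exact: ck.
  by apply: cvgM; [exact: cvg_cst|exact: cvg_id].
have cM g : continuous g -> continuous (fun x => g x * k (l * x)).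
  by move=> cg x; apply: cvgM; [exact: cg|exact: ckl].
have iu : mu.-integrable setT (EFin \o (fun x => u x * k (l * x))).
  apply: (@integrable_cpt _ A); first exact: cM.
  by move=> x /(C2c_outside uc)[-> _ _]; rewrite mul0r.
have iu2 : mu.-integrable setT (EFin \o (fun x => u2 x * k (l * x))).
  apply: (@integrable_cpt _ A); first exact: cM.
  by move=> x /(C2c_outside uc)[_ _ ->]; rewrite mul0r.
apply/eqP; rewrite -addr_eq0 -RintegralZl// -RintegralD//; last first.
  exact: (integrableZl _ (l ^+ 2) iu).
apply/eqP.
(* The terms in u1 k' cancel in the derivative of u1 k - l u k'. *)
apply: (@Rintegral_derive_eq0 _ A (fun x => u1 x * k (l * x) - l * (u x * kd (l * x)))) => //.
- move=> x; apply: cvgD; last exact: cM.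
  by apply: cvgM; [exact: cvg_cst|exact: cM].
- move=> x.
  have dl : is_derive x 1 (fun x : R => l * x) l.
    by have := is_deriveZ l (is_derive_id x 1); rewrite /GRing.scale/= mulr1.
  have dkl := is_derive1_comp (dk (l * x)) dl.
  have dkdl := is_derive1_comp (dkd (l * x)) dl.
  have dF := is_deriveB (is_deriveM (d2 x) dkl)
    (is_deriveZ l (is_deriveM (d1 x) dkdl)).
  by apply: (is_derive_eq dF); rewrite /GRing.scale/=; ring.
- by move=> x /(C2c_outside uc)[-> -> _]; rewrite !mul0r mulr0 subrr.
- by move=> x /(C2c_outside uc)[-> _ ->]; rewrite !mul0r mulr0 addr0.
Qed.

(** After multiplication by [1 + l^2] there are two terms, the integral of [u] and, by parts, that
    of [u2]; each is at most [2 * A * M]. *)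
Lemma transform_decay A M u u1 u2 k kd l : 0 < A -> C2c A u u1 u2 ->
  (forall x, `|u x| <= M) -> (forall x, `|u2 x| <= M) -> oscillator k kd ->
  `|\int[mu]_x (u x * k (l * x))| <= 4 * A * M * (oneDsqr l)^-1.
Proof.
move=> A0 uc uM u2M ok; have [dk dkd k1] := ok.
have [cu2 d1 d2 u0] := uc.
have bound g : continuous g -> (forall x, A < `|x| -> g x = 0) ->
    (forall x, `|g x| <= M) -> `|\int[mu]_x (g x * k (l * x))| <= 2 * A * M.
  move=> cg g0 gM; apply: Rintegral_cpt_le => //; last first.
  - move=> x; rewrite normrM -[M]mulr1; exact: ler_pM.
  - exact: ltW.
  - by move=> x /g0 ->; rewrite mul0r.
  - move=> x; apply: cvgM; first exact: cg.
    apply: continuous_comp; last exact: is_derive_continuous dk _.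
    by apply: cvgM; [exact: cvg_cst|exact: cvg_id].
have b0 := bound _ (is_derive_continuous d1) u0 uM.
have b2 := bound _ cu2 (fun x xA => let: And3 _ _ e := C2c_outside uc xA in e) u2M.
have l0 : 0 < oneDsqr l by apply: lt_le_trans (oneDsqr_ge1 l).
rewrite ler_pdivlMr// /oneDsqr mulrDr mulr1.
have -> : 4 * A * M = 2 * A * M + 2 * A * M by ring.
rewrite lerD// -(ger0_norm (sqr_ge0 l)) -normrM mulrC.
by rewrite (transform_by_parts l A0 uc ok) normrN.
Qed.

Lemma C2c_bounded A u u1 u2 : 0 < A -> C2c A u u1 u2 ->
  exists M, (forall x, `|u x| <= M) /\ (forall x, `|u2 x| <= M).
Proof.
move=> A0 uc; have [cu2 d1 d2 u0] := uc.
have bd g : continuous g -> (forall x, A < `|x| -> g x = 0) ->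
    exists M, forall x, `|g x| <= M.
  move=> cg g0.
  have /compact_bounded[M [_ Mg]] : compact (g @` `[- A, A]).
    apply: continuous_compact; last exact: segment_compact.
    exact: continuous_subspaceT.
  (* Compactness provides as bounds all numbers strictly above [M]; this one is also nonnegative, as
     the region where [g] vanishes requires. *)
  exists (`|M| + 1) => x.
  have [Ax|xA] := ltP A `|x|; first by rewrite g0// normr0 addr_ge0.
  apply: Mg; first by rewrite ltr_pwDr// ler_norm.
  by exists x => //=; rewrite in_itv/= -ler_norml.
have [M1 h1] := bd _ (is_derive_continuous d1) u0.
have [M2 h2] := bd _ cu2 (fun x xA => let: And3 _ _ e := C2c_outside uc xA in e).
exists (M1 + M2); split=> x.
- by rewrite (le_trans (h1 x))// lerDl (le_trans _ (h2 x)).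
- by rewrite (le_trans (h2 x))// lerDr (le_trans _ (h1 x)).
Qed.

Lemma integrable_transform A u u1 u2 k kd : 0 < A -> C2c A u u1 u2 ->
  oscillator k kd ->
  mu.-integrable setT (EFin \o (fun l => \int[mu]_x (u x * k (l * x)))).
Proof.
move=> A0 uc ok; have [M [uM u2M]] := C2c_bounded A0 uc.
have [dk _ k1] := ok; have [_ d1 _ u0] := uc.
have M0 : 0 <= M by rewrite (le_trans _ (uM 0)).
have := integrableZl measurableT (4 * A * M) integrable_oneDsqrV.
apply: le_integrable => //.
  apply/measurable_EFinP; apply: continuous_measurable_fun.
  apply: (@continuous_transform _ _ _ 1) => //.
  - apply: (@integrable_cpt _ A) => //; exact: is_derive_continuous d1.
  - exact: is_derive_continuous dk.
move=> l _; rewrite lee_fin.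
apply: (le_trans (transform_decay l A0 uc uM u2M ok)).
exact: ler_norm.
Qed.

End Transforms.

(** * Division of a function vanishing near [y] by a sine vanishing at [y] *)

Section DivideBySine.
Context {R : realType}.
Implicit Types (f s u : R -> R) (A h x y : R).

(** The quotient rule survives at a zero of [s]: there [f] vanishes locally, so the quotient is
    locally 0 and the numerator of the formula is 0 too. *)
Lemma is_derive_div_near f df s ds x : is_derive x 1 f df ->
  is_derive x 1 s ds -> s x != 0 \/ (\forall z \near x, f z = 0) ->
  is_derive x 1 (fun z => f z / s z) ((df * s x - f x * ds) / s x ^+ 2).
Proof.
move=> fd sd [sx0|f0].
  have ex : derivable s x 1 by exact: ex_derive.
  have iv : is_derive x 1 (fun z => (s z)^-1) (- (s x) ^- 2 *: ds).
    have := DeriveDef (derivableV sx0 ex) (deriveV sx0 ex).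
    by rewrite (@derive_val _ _ _ _ _ _ _ sd).
  apply: (is_derive_eq (is_deriveM fd iv)).
  by rewrite /GRing.scale/=; field.
have -> : df = 0 by exact: is_derive_near0 fd.
have -> : f x = 0 by exact: nbhs_singleton f0.
rewrite !mul0r subrr mul0r.
apply: (@near_eq_is_derive _ _ _ (cst 0)) => //.
by apply: filterS f0 => z -> /=; rewrite mul0r.
Qed.

Lemma near0_derive f (df : R -> R) x : (forall z : R, is_derive z 1 f (df z)) ->
  (\forall z \near x, f z = 0) -> \forall z \near x, df z = 0.
Proof.
move=> fd /nbhs_interior; apply: filterS => z f0.
exact: is_derive_near0 (fd z).
Qed.

(** Take the quotient of [u] by the sine. Wherever the sine vanishes, [u] is locally zero, so the
    usual formulas for the first two derivatives hold everywhere. *)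
Lemma C2c_div_sin A u u1 u2 y : 0 < A -> C2c A u u1 u2 ->
  (\forall z \near y, u z = 0) ->
  exists h g g1 g2, C2c A g g1 g2 /\ forall x, u x = sin (h * (x - y)) * g x.
Proof.
move=> A0 uc uy; have [cu2 d1 d2 u0] := uc.
(* This h makes |h (x - y)| < 1 < pi on [-A, A], so that the sine vanishes
   there only at y. *)
pose h := (A + `|y| + 1)^-1.
have y0 := normr_ge0 y.
have B0 : 0 < A + `|y| + 1 by lra.
have h0 : 0 < h by rewrite invr_gt0.
pose s x := sin (h * (x - y)).
pose s1 x := h * cos (h * (x - y)).
pose s2 x := - h ^+ 2 * s x.
have dl x : is_derive x 1 (fun z : R => h * (z - y)) h.
  have dd := is_deriveZ h (is_deriveB (is_derive_id x 1) (is_derive_cst y x 1)).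
  by apply: (is_derive_eq dd); rewrite subr0 /GRing.scale/= mulr1.
have ds1 x : is_derive x 1 s (s1 x).
  apply: (is_derive_eq (is_derive1_comp (is_derive_sin _) (dl x))).
  by rewrite mulrC.
have ds2 x : is_derive x 1 s1 (s2 x).
  apply: (is_derive_eq (is_deriveZ h (is_derive1_comp (is_derive_cos _) (dl x)))).
  by rewrite /GRing.scale/= /s2 /s; ring.
(* This dichotomy is the condition of [is_derive_div_near]: outside [[-A, A]] and at [y] the
   function [u] is locally zero, and elsewhere the sine has a nonzero argument of modulus below
   [pi]. *)
have loc x : s x != 0 \/ (\forall z \near x, u z = 0).
  have [Ax|xA] := ltP A `|x|.
    by right; apply: filterS (near_norm_gt Ax) => z /u0.
  have [->|xy] := eqVneq x y; first by right.
  left; rewrite /s.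
  have small : `|h * (x - y)| < pi.
    apply: (@lt_le_trans _ _ 1); last by rewrite (le_trans _ (pi_ge2 R))// ler1n.
    rewrite normrM (gtr0_norm h0) mulrC ltr_pdivrMr// mul1r.
    by rewrite (le_lt_trans (ler_normB _ _))//; lra.
  have nz : h * (x - y) != 0 by rewrite mulf_neq0 ?subr_eq0// gt_eqF.
  case: (ltgtP (h * (x - y)) 0) nz => // t0 _.
    rewrite -oppr_eq0 -sinN gt_eqF// sin_gt0_pi// oppr_gt0 t0/=.
    by rewrite -(ltr0_norm t0).
  by rewrite gt_eqF// sin_gt0_pi// t0/= -(gtr0_norm t0).
(* [n1] is the numerator of the first derivative of [u / s], and [m1] is the derivative of [n1], in
   which the products [u1 s1] cancel. *)
pose n1 x := u1 x * s x - u x * s1 x.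
pose m1 x := u2 x * s x - u x * s2 x.
have dn x : is_derive x 1 n1 (m1 x).
  apply: (is_derive_eq (is_deriveB (is_deriveM (d2 x) (ds1 x)) (is_deriveM (d1 x) (ds2 x)))).
  by rewrite /GRing.scale/= /m1; ring.
have dss x : is_derive x 1 (fun z => s z ^+ 2) (2 * s x * s1 x).
  apply: (is_derive_eq (is_deriveM (ds1 x) (ds1 x))).
  by rewrite /GRing.scale/=; ring.
have locn x : (\forall z \near x, u z = 0) -> \forall z \near x, n1 z = 0.
  move=> ux; have u1x := near0_derive d1 ux.
  by near=> z; rewrite /n1 (near ux)// (near u1x)// !mul0r subrr.
exists h, (fun x => u x / s x), (fun x => n1 x / s x ^+ 2),
  (fun x => (m1 x * s x ^+ 2 - n1 x * (2 * s x * s1 x)) / (s x ^+ 2) ^+ 2).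
have cu := is_derive_continuous d1; have cu1 := is_derive_continuous d2.
have cs := is_derive_continuous ds1; have cs1 := is_derive_continuous ds2.
have cs2 : continuous s2 by move=> x; apply: cvgM; [exact: cvg_cst|exact: cs].
split; first split.
(* Continuity of the second derivative: a quotient of continuous functions where [s] is nonzero,
   locally constant 0 elsewhere. *)
- move=> x; case: (loc x) => [sx|ux].
    have css : {for x, continuous (fun z => s z ^+ 2)}.
      by apply: cvgM; exact: cs.
    apply: cvgM; last first.
      apply: cvgV; first by rewrite !expf_neq0.
      by apply: cvgM; exact: css.
    apply: cvgB; apply: cvgM => //.
    + by apply: cvgB; apply: cvgM; [exact: cu2|exact: cs|exact: cu|exact: cs2].
    + by apply: cvgB; apply: cvgM; [exact: cu1|exact: cs|exact: cu|exact: cs1].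
    + apply: cvgM; last exact: cs1.
      by apply: cvgM; [exact: cvg_cst|exact: cs].
  have nx := locn x ux; have mx := near0_derive dn nx.
  have gx : \forall z \near x, (m1 z * s z ^+ 2 - n1 z * (2 * s z * s1 z)) / (s z ^+ 2) ^+ 2 = 0.
    by near=> z; rewrite (near nx)// (near mx)// !mul0r subrr mul0r.
  exact: (near_cst_continuous 0 gx).
- by move=> x; apply: is_derive_div_near (d1 x) (ds1 x) (loc x).
- move=> x; apply: is_derive_div_near (dn x) (dss x) _.
  by case: (loc x) => [sx|/locn]; [left; rewrite expf_neq0|right].
- by move=> x /u0 ->; rewrite mul0r.
- move=> x; case: (loc x) => [sx|ux]; first by rewrite mulrC divfK.
  by rewrite (nbhs_singleton ux) mul0r mulr0.
Unshelve. all: by end_near. Qed.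

End DivideBySine.

(** * Complex integrals *)

Section ComplexIntegral.
Local Open Scope complex_scope.
Context {R : realType}.
Local Notation mu := (@lebesgue_measure R).
Local Notation Re := (@complex.Re R).
Local Notation Im := (@complex.Im R).
Implicit Types (f g H K : R -> R[i]) (z : R[i]).

Lemma Re_add z1 z2 : Re (z1 + z2) = Re z1 + Re z2.
Proof. by case: z1 z2 => [? ?] []. Qed.
Lemma Im_add z1 z2 : Im (z1 + z2) = Im z1 + Im z2.
Proof. by case: z1 z2 => [? ?] []. Qed.
Lemma Re_mul z1 z2 : Re (z1 * z2) = Re z1 * Re z2 - Im z1 * Im z2.
Proof. by case: z1 z2 => [? ?] []. Qed.
Lemma Im_mul z1 z2 : Im (z1 * z2) = Re z1 * Im z2 + Im z1 * Re z2.
Proof. by case: z1 z2 => [? ?] []. Qed.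

Lemma complex_eqP z1 z2 : Re z1 = Re z2 -> Im z1 = Im z2 -> z1 = z2.
Proof. by case: z1 z2 => [? ?] [? ?] /= -> ->. Qed.

Definition cintegrable f :=
  mu.-integrable setT (EFin \o (Re \o f)) /\
  mu.-integrable setT (EFin \o (Im \o f)).

Lemma cintegralD f g : cintegrable f -> cintegrable g ->
  cintegral setT (fun x => f x + g x) = cintegral setT f + cintegral setT g.
Proof.
move=> [rf jf] [rg jg]; apply: complex_eqP; rewrite ?Re_add ?Im_add /=.
  by rewrite -RintegralD//; apply: eq_Rintegral => x _; rewrite Re_add.
by rewrite -RintegralD//; apply: eq_Rintegral => x _; rewrite Im_add.
Qed.

Lemma integrable_lin2 (p q : R -> R) (a b : R) :
  mu.-integrable setT (EFin \o p) -> mu.-integrable setT (EFin \o q) ->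
  mu.-integrable setT (EFin \o (fun x => a * p x + b * q x)).
Proof.
move=> pi qi; exact: integrableD (integrableZl _ a pi) (integrableZl _ b qi).
Qed.

Lemma Rintegral_lin2 (p q : R -> R) (a b : R) :
  mu.-integrable setT (EFin \o p) -> mu.-integrable setT (EFin \o q) ->
  \int[mu]_x (a * p x + b * q x) = a * \int[mu]_x p x + b * \int[mu]_x q x.
Proof.
move=> pi qi; rewrite RintegralD//; first by rewrite !RintegralZl.
- exact: (integrableZl _ a pi).
- exact: (integrableZl _ b qi).
Qed.

Lemma cintegrableZ z f : cintegrable f -> cintegrable (fun x => z * f x).
Proof.
move=> [rf jf]; split.
  have := integrable_lin2 (Re z) (- Im z) rf jf.
  by apply: eq_integrable => // x _; rewrite /= Re_mul mulNr.
have := integrable_lin2 (Im z) (Re z) rf jf.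
by apply: eq_integrable => // x _; rewrite /= Im_mul addrC.
Qed.

Lemma cintegrableD f g : cintegrable f -> cintegrable g ->
  cintegrable (fun x => f x + g x).
Proof.
move=> [rf jf] [rg jg]; split.
  have := integrableD measurableT rf rg.
  by apply: eq_integrable => // x _; rewrite /= Re_add.
have := integrableD measurableT jf jg.
by apply: eq_integrable => // x _; rewrite /= Im_add.
Qed.

Lemma cintegralZ z f : cintegrable f ->
  cintegral setT (fun x => z * f x) = z * cintegral setT f.
Proof.
move=> [rf jf]; apply: complex_eqP; rewrite ?Re_mul ?Im_mul /=.
  rewrite -mulNr -Rintegral_lin2//.
  by apply: eq_Rintegral => x _; rewrite Re_mul mulNr.
rewrite addrC -Rintegral_lin2//.
by apply: eq_Rintegral => x _; rewrite Im_mul addrC.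
Qed.

(** These are the multipliers of integrable functions. They form an algebra containing the
    characters and the transforms of weights, hence also the determinant. *)
Definition bounded_measurable H := [/\ measurable_fun setT (Re \o H),
  measurable_fun setT (Im \o H) &
  exists B, forall x, `|Re (H x)| <= B /\ `|Im (H x)| <= B].

Lemma cintegrableM H K : bounded_measurable H -> cintegrable K ->
  cintegrable (fun x => H x * K x).
Proof.
move=> [mr mi [B HB]] [rk ik].
have rB x : `|Re (H x)| <= B by have [] := HB x.
have iB x : `|Im (H x)| <= B by have [] := HB x.
split.
  have := integrableB measurableT (integrable_bndM mr rB rk)
    (integrable_bndM mi iB ik).
  by apply: eq_integrable => // x _; rewrite /= Re_mul.
have := integrableD measurableT (integrable_bndM mr rB ik)
  (integrable_bndM mi iB rk).
by apply: eq_integrable => // x _; rewrite /= Im_mul.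
Qed.

Lemma bounded_measurable_cst z : bounded_measurable (fun=> z).
Proof.
split; [exact: measurable_cst|exact: measurable_cst|].
by exists (`|Re z| + `|Im z|) => x; rewrite lerDl lerDr.
Qed.

Lemma bounded_measurableD H K : bounded_measurable H -> bounded_measurable K ->
  bounded_measurable (fun x => H x + K x).
Proof.
move=> [mr mi [B HB]] [mr' mi' [B' HB']]; split.
- rewrite (_ : _ \o _ = (Re \o H) \+ (Re \o K)); last first.
    by apply/funext => x; rewrite /= Re_add.
  exact: measurable_funD.
- rewrite (_ : _ \o _ = (Im \o H) \+ (Im \o K)); last first.
    by apply/funext => x; rewrite /= Im_add.
  exact: measurable_funD.
exists (B + B') => x; have [h1 h2] := HB x; have [k1 k2] := HB' x.
by rewrite Re_add Im_add; split; rewrite (le_trans (ler_normD _ _))// lerD.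
Qed.

Lemma bounded_measurableM H K : bounded_measurable H -> bounded_measurable K ->
  bounded_measurable (fun x => H x * K x).
Proof.
move=> [mr mi [B HB]] [mr' mi' [B' HB']]; split.
- rewrite (_ : _ \o _ = (Re \o H) \* (Re \o K) \- (Im \o H) \* (Im \o K)); last first.
    by apply/funext => x; rewrite /= Re_mul.
  by apply: measurable_funB; exact: measurable_funM.
- rewrite (_ : _ \o _ = (Re \o H) \* (Im \o K) \+ (Im \o H) \* (Re \o K)); last first.
    by apply/funext => x; rewrite /= Im_mul.
  by apply: measurable_funD; exact: measurable_funM.
exists (B * B' + B * B') => x; have [h1 h2] := HB x; have [k1 k2] := HB' x.
rewrite Re_mul Im_mul; split.
  by rewrite (le_trans (ler_normB _ _))// lerD// normrM ler_pM.
by rewrite (le_trans (ler_normD _ _))// lerD// normrM ler_pM.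
Qed.

Definition cis (t : R) : R[i] := cos t +i* sin t.

Lemma cexp_i (t : R) : cexp ('i%C * t%:C) = cis t.
Proof.
rewrite /cexp (_ : 'i%C * t%:C = 0 +i* t); last by apply: complex_eqP; rewrite ?Re_mul ?Im_mul/=; ring.
by rewrite /= expR0 mul1r.
Qed.

Lemma cis_add s t : cis (s + t) = cis s * cis t.
Proof.
apply: complex_eqP; rewrite ?Re_mul ?Im_mul /= ?cosD ?sinD//.
by rewrite addrC [sin s * _]mulrC; ring.
Qed.

Lemma bounded_measurable_cis y : bounded_measurable (fun l => cis (y * l)).
Proof.
have ml : measurable_fun setT (fun l : R => y * l) by exact: measurable_funM.
split.
- apply: (measurableT_comp _ ml); apply: continuous_measurable_fun.
  exact: continuous_cos.
- apply: (measurableT_comp _ ml); apply: continuous_measurable_fun.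
  exact: continuous_sin.
by exists 1 => l /=; rewrite !ler_norml cos_geN1 cos_le1 sin_geN1 sin_le1.
Qed.

(** For the weights [x^m x^alpha (1-x)^beta] on [[0, 1]] these are the entries of the determinant
    [Dn] at [- i l]. *)
Definition weight_transform (D : set R) (w : R -> R) (l : R) : R[i] :=
  (\int[mu]_(x in D) (w x * cos (l * x))) +i*
  (\int[mu]_(x in D) (w x * sin (l * x))).

Section WeightTransform.
Variables (D : set R) (w : R -> R).
Hypotheses (mD : measurable (D : set (measurableTypeR R)))
  (wi : mu.-integrable D (EFin \o w)).

Lemma bounded_transform (k : R -> R) : continuous k -> (forall x, `|k x| <= 1) ->
  forall l, `|\int[mu]_(x in D) (w x * k (l * x))| <= \int[mu]_(x in D) `|w x|.
Proof.
move=> ck k1 l.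
have mw : measurable_fun D w by apply/measurable_EFinP; exact: (measurable_int mu).
have wki : mu.-integrable D (EFin \o (fun x => w x * k (l * x))).
  apply: le_integrable wi => //.
    apply/measurable_EFinP; apply: measurable_funM => //.
    apply: measurable_funTS; apply: measurableT_comp; last exact: measurable_funM.
    exact: continuous_measurable_fun.
  by move=> x _; rewrite lee_fin normrM ler_piMr.
apply: (le_trans (le_normr_Rintegral mD wki)).
apply: le_Rintegral => //; [exact: integrable_norm|exact: integrable_norm|].
by move=> x _; rewrite normrM ler_piMr.
Qed.

Let cos1 x : `|cos x : R| <= 1. Proof. by rewrite ler_norml cos_geN1 cos_le1. Qed.
Let sin1 x : `|sin x : R| <= 1. Proof. by rewrite ler_norml sin_geN1 sin_le1. Qed.

Lemma bounded_measurable_weight : bounded_measurable (weight_transform D w).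
Proof.
split.
- apply: continuous_measurable_fun.
  exact: (continuous_transform mD wi (@continuous_cos R) cos1).
- apply: continuous_measurable_fun.
  exact: (continuous_transform mD wi (@continuous_sin R) sin1).
by exists (\int[mu]_(x in D) `|w x|) => l; split; apply: bounded_transform => //;
  [exact: continuous_cos|exact: continuous_sin].
Qed.

(** By Fubini, the left side is the average over [x] in [D], with weight [w x], of the pairings
    assumed to vanish. Fubini is available for real functions, so the components are treated
    separately. *)
Lemma cintegral_weight_eq0 K : cintegrable K ->
  (forall x, D x -> cintegral setT (fun l => cis (l * x) * K l) = 0) ->
  cintegral setT (fun l => weight_transform D w l * K l) = 0.
Proof.
move=> Ki EK0.
have [rK iK] := Ki.
have [mr mi [B HB]] := bounded_measurable_weight.
have rB x : `|Re (weight_transform D w x)| <= B by have [] := HB x.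
have iB x : `|Im (weight_transform D w x)| <= B by have [] := HB x.
have ci (k p : R -> R) (x : R) : continuous k -> (forall y : R, `|k y| <= 1) ->
    mu.-integrable setT (EFin \o p) ->
    mu.-integrable setT (EFin \o (fun l => k (l * x) * p l)).
  move=> ck k1 pi; apply: (@integrable_bndM _ (fun l => k (l * x)) p 1) => //.
  apply: measurableT_comp; last exact: measurable_funM.
  exact: continuous_measurable_fun.
have cc := @continuous_cos R; have cs := @continuous_sin R.
apply: complex_eqP => /=.
  under eq_Rintegral do rewrite Re_mul.
  rewrite RintegralB//; last 2 first.
  - exact: (integrable_bndM mr rB rK).
  - exact: (integrable_bndM mi iB iK).
  rewrite (Rfubini mD wi rK cc cos1) (Rfubini mD wi iK cs sin1).
  apply/eqP; rewrite subr_eq0; apply/eqP; apply: eq_Rintegral => x /set_mem Dx.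
  congr (_ * _); apply/eqP; rewrite -subr_eq0 -RintegralB//; last 2 first.
  - exact: ci.
  - exact: ci.
  apply/eqP; have := congr1 Re (EK0 _ Dx) => /= <-.
  by apply: eq_Rintegral => l _; rewrite Re_mul.
(* The imaginary part of a product is a sum; writing it as a difference with [- Re K] lets the
   argument for the real part repeat. *)
have rNK : mu.-integrable setT (EFin \o (\- (Re \o K))).
  by apply: eq_integrable (integrableZl measurableT (-1) rK) => // x _; rewrite /= -EFinM mulN1r.
under eq_Rintegral do rewrite Im_mul -[X in _ + X]opprK -mulrN.
rewrite RintegralB//; last 2 first.
- exact: (integrable_bndM mr rB iK).
- exact: (integrable_bndM mi iB rNK).
rewrite (Rfubini mD wi iK cc cos1) (Rfubini mD wi rNK cs sin1).
apply/eqP; rewrite subr_eq0; apply/eqP; apply: eq_Rintegral => x /set_mem Dx.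
congr (_ * _); apply/eqP; rewrite -subr_eq0 -RintegralB//; last 2 first.
- exact: ci.
- exact: (ci _ (\- (Re \o K))).
apply/eqP; have := congr1 Im (EK0 _ Dx) => /= <-.
by apply: eq_Rintegral => l _; rewrite Im_mul mulrN opprK.
Qed.

End WeightTransform.

End ComplexIntegral.

(** * Vanishing of the pairing *)

Section Vanishing.
Local Open Scope complex_scope.
Context {R : realType}.
Local Notation mu := (@lebesgue_measure R).
Local Notation Re := (@complex.Re R).
Local Notation Im := (@complex.Im R).
Implicit Types (H K : R -> R[i]) (u : R -> R).

(* The transform with kernel e^{-ilx}, whereas weight_transform uses e^{ilx}. *)
Definition uhat u (l : R) : R[i] :=
  (\int[mu]_x (u x * cos (l * x))) -i* (\int[mu]_x (u x * sin (l * x))).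

Lemma continuous_cos_affine (l y : R) : continuous (fun x => cos (l * (x + y))).
Proof.
move=> x; apply: continuous_comp; last exact: continuous_cos.
apply: cvgM; first exact: cvg_cst.
by apply: cvgD; [exact: cvg_id|exact: cvg_cst].
Qed.

Lemma continuous_sin_affine (l y : R) : continuous (fun x => sin (l * (x + y))).
Proof.
move=> x; apply: continuous_comp; last exact: continuous_sin.
apply: cvgM; first exact: cvg_cst.
by apply: cvgD; [exact: cvg_id|exact: cvg_cst].
Qed.

Section C2c.
Variables (A : R) (u u1 u2 : R -> R).
Hypotheses (A0 : 0 < A) (uc : C2c A u u1 u2).

Lemma cintegrable_uhat : cintegrable (uhat u).
Proof.
split; first exact: (integrable_transform A0 uc oscillator_cos).
have := integrableZl measurableT (-1) (integrable_transform A0 uc oscillator_sin).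
by apply: eq_integrable => // x _; rewrite /= -EFinM mulN1r.
Qed.

Lemma integrable_C2cM (k : R -> R) : continuous k ->
  mu.-integrable setT (EFin \o (fun x => u x * k x)).
Proof.
move=> ck; have [_ d1 _ _] := uc.
apply: (@integrable_cpt _ A).
  by move=> x; apply: cvgM; [exact: (is_derive_continuous d1)|exact: ck].
by move=> x /(C2c_outside uc)[-> _ _]; rewrite mul0r.
Qed.

(** The character recentres the kernel at [y], where it can be combined with the factor
    [sin (h * (x - y))]. *)
Lemma cis_uhat y l : cis (y * l) * uhat u l =
  (\int[mu]_x (u x * cos (l * (x - y)))) -i* (\int[mu]_x (u x * sin (l * (x - y)))).
Proof.
have ic : mu.-integrable setT (EFin \o (fun x => u x * cos (l * x))).
  by apply: eq_integrable (integrable_C2cM (@continuous_cos_affine l 0)) => // x _; rewrite /= addr0.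
have is_ : mu.-integrable setT (EFin \o (fun x => u x * sin (l * x))).
  by apply: eq_integrable (integrable_C2cM (@continuous_sin_affine l 0)) => // x _; rewrite /= addr0.
apply: complex_eqP; rewrite ?Re_mul ?Im_mul /=.
  rewrite mulrN opprK -Rintegral_lin2//; apply: eq_Rintegral => x _.
  by rewrite mulrBr cosB [y * l]mulrC; ring.
rewrite mulrN addrC -mulrN -[X in _ + cos _ * X]mulN1r mulrA -Rintegral_lin2//.
rewrite -[RHS]mulN1r -RintegralZl//; last exact: integrable_C2cM (@continuous_sin_affine _ _).
apply: eq_Rintegral => x _.
by rewrite mulrBr sinB [y * l]mulrC; ring.
Qed.

End C2c.

(** This is Fourier inversion at a point near which [u] vanishes, obtained by writing the integrand
    as a difference of two translates of one integrable function. *)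
Lemma cintegral_uhat_eq0 A u u1 u2 (y : R) : 0 < A -> C2c A u u1 u2 ->
  (\forall x \near y, u x = 0) ->
  cintegral setT (fun l => cis (y * l) * uhat u l) = 0.
Proof.
move=> A0 uc uy; have [h [g [g1 [g2 [gc ug]]]]] := C2c_div_sin A0 uc uy.
pose G l := cis (y * l) * uhat g l.
have [rG iG] : cintegrable G.
  apply: cintegrableM (cintegrable_uhat A0 gc).
  exact: bounded_measurable_cis.
(* With [t = x - y], this is the identity [sin(ht) e^{-ilt} = (i/2) (e^{-i(l+h)t} - e^{-i(l-h)t})]
   integrated against [g]. *)
have key l : cis (y * l) * uhat u l =
    (2^-1 *i) * (G (l + h) + (- 1) * G (l - h)).
  rewrite /G (cis_uhat uc) !(cis_uhat gc).
  have ic a : mu.-integrable setT (EFin \o (fun x => g x * cos (a * (x - y)))).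
    exact: (integrable_C2cM gc (@continuous_cos_affine a (- y))).
  have is_ a : mu.-integrable setT (EFin \o (fun x => g x * sin (a * (x - y)))).
    exact: (integrable_C2cM gc (@continuous_sin_affine a (- y))).
  apply: complex_eqP => /=.
    transitivity (2^-1 * (\int[mu]_x (g x * sin ((l + h) * (x - y)))) +
        - 2^-1 * (\int[mu]_x (g x * sin ((l - h) * (x - y))))); last by ring.
    rewrite -Rintegral_lin2//; apply: eq_Rintegral => x _.
    by rewrite ug [(l + h) * _]mulrDl [(l - h) * _]mulrBl sinB sinD; field.
  transitivity (2^-1 * (\int[mu]_x (g x * cos ((l + h) * (x - y)))) +
      - 2^-1 * (\int[mu]_x (g x * cos ((l - h) * (x - y))))); last by ring.
  rewrite -Rintegral_lin2// -mulN1r -RintegralZl//; last first.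
    exact: (integrable_C2cM uc (@continuous_sin_affine l (- y))).
  apply: eq_Rintegral => x _.
  by rewrite ug [(l + h) * _]mulrDl [(l - h) * _]mulrBl cosB cosD; field.
have shiftG (a : R) : cintegrable (fun l => G (l + a)) /\
    cintegral setT (fun l => G (l + a)) = cintegral setT G.
  split; first split.
  - exact: (@integrable_shift _ (Re \o G)).
  - exact: (@integrable_shift _ (Im \o G)).
  - have eR := Rintegral_shift a rG; have eI := Rintegral_shift a iG.
    by rewrite /= in eR eI; rewrite /cintegral eR eI.
have [iGp Gp] := shiftG h; have [iGm Gm] := shiftG (- h).
have iGm' := cintegrableZ (-1) iGm.
under eq_fun do rewrite key.
rewrite cintegralZ; last exact: cintegrableD.
by rewrite (cintegralD iGp iGm') (cintegralZ _ iGm) Gp Gm mulN1r subrr mulr0.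
Qed.

(* H is to be thought of as the transform of a measure supported in [0, m];
   the factor cis (y * l) translates by y. *)
Definition annihilates (m : R) H := bounded_measurable H /\
  forall y A u u1 u2, 0 < A -> C2c A u u1 u2 ->
    (forall t, y <= t <= y + m -> \forall x \near t, u x = 0) ->
    cintegral setT (fun l => cis (y * l) * (H l * uhat u l)) = 0.

(** The constant 1 is the transform of the Dirac mass at 0. *)
Lemma annihilates1 : annihilates 0 (fun=> 1).
Proof.
split=> [|y A u u1 u2 A0 uc uy]; first exact: bounded_measurable_cst.
under eq_fun do rewrite mul1r.
by apply: (cintegral_uhat_eq0 A0 uc); apply: uy; rewrite addr0 lexx.
Qed.

(** Multiplying transforms convolves measures, so a weight on [[0, 1]] lengthens the interval by 1.
    Concretely, for each [x] in [[0, 1]] the character [e^{ilx}] moves [y] to [y + x], and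
    [[y + x, y + x + m]] lies in [[y, y + m + 1]]. *)
Lemma annihilates_weight m (w : R -> R) H :
  mu.-integrable `[0, 1] (EFin \o w) -> annihilates m H ->
  annihilates (m + 1) (fun l => weight_transform `[0, 1]%classic w l * H l).
Proof.
have mI : measurable (`[0, 1]%classic : set (measurableTypeR R)).
  exact: measurable_itv.
move=> wi [bH H0]; split.
  by apply: bounded_measurableM => //; exact: bounded_measurable_weight.
move=> y A u u1 u2 A0 uc uy.
have -> : (fun l => cis (y * l) * (weight_transform `[0, 1]%classic w l * H l * uhat u l))
  = (fun l => weight_transform `[0, 1]%classic w l * (cis (y * l) * (H l * uhat u l))).
  by apply/funext => l; ring.
apply: cintegral_weight_eq0 => //.
  apply: cintegrableM; first exact: bounded_measurable_cis.
  exact: cintegrableM (cintegrable_uhat A0 uc).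
move=> x; rewrite /= in_itv/= => /andP[x0 x1].
rewrite -[RHS](H0 (y + x) A u u1 u2 A0 uc).
  congr cintegral; apply/funext => l.
  by rewrite mulrA -cis_add mulrDl addrC [x * l]mulrC.
by move=> t /andP[yt tm]; apply: uy; apply/andP; split; lra.
Qed.

Lemma annihilatesD m H K : annihilates m H -> annihilates m K ->
  annihilates m (fun l => H l + K l).
Proof.
move=> [bH H0] [bK K0]; split; first exact: bounded_measurableD.
move=> y A u u1 u2 A0 uc uy.
have iu := cintegrable_uhat A0 uc.
have bc := bounded_measurable_cis y.
under eq_fun do rewrite mulrDl mulrDr.
rewrite cintegralD; last 2 first.
- by apply: cintegrableM => //; exact: cintegrableM.
- by apply: cintegrableM => //; exact: cintegrableM.
by rewrite (H0 _ _ _ _ _ A0 uc)// (K0 _ _ _ _ _ A0 uc)// addr0.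
Qed.

Lemma annihilatesZ m z H : annihilates m H -> annihilates m (fun l => z * H l).
Proof.
move=> [bH H0]; split.
  by apply: bounded_measurableM => //; exact: bounded_measurable_cst.
move=> y A u u1 u2 A0 uc uy.
have -> : (fun l => cis (y * l) * (z * H l * uhat u l)) =
    (fun l => z * (cis (y * l) * (H l * uhat u l))).
  by apply/funext => l; ring.
rewrite cintegralZ; first by rewrite (H0 _ _ _ _ _ A0 uc)// mulr0.
apply: cintegrableM; first exact: bounded_measurable_cis.
exact: cintegrableM (cintegrable_uhat A0 uc).
Qed.

Lemma annihilates0 m : annihilates m (fun=> 0).
Proof.
split=> [|y A u u1 u2 A0 uc uy]; first exact: bounded_measurable_cst.
under eq_fun do rewrite mul0r mulr0.
by apply: complex_eqP => /=; rewrite (@Rintegral_cst _ _ _ mu _ measurableT 0) mul0r.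
Qed.

Lemma annihilates_prod n (w : 'I_n -> R -> R) :
  (forall i, mu.-integrable `[0, 1] (EFin \o w i)) ->
  annihilates n%:R (fun l => \prod_i weight_transform `[0, 1]%classic (w i) l).
Proof.
elim: n w => [|n IH] w wi.
  by under eq_fun do rewrite big_ord0; exact: annihilates1.
under eq_fun do rewrite big_ord_recl.
rewrite -natr1; apply: annihilates_weight; first exact: wi.
by apply: IH => i; exact: wi.
Qed.

Lemma annihilates_sum m (I : Type) (s : seq I) (c : I -> R[i]) (H : I -> R -> R[i]) :
  (forall i, annihilates m (H i)) ->
  annihilates m (fun l => \sum_(i <- s) c i * H i l).
Proof.
move=> aH; elim: s => [|i s IH].
  by under eq_fun do rewrite big_nil; exact: annihilates0.
under eq_fun do rewrite big_cons.
by apply: annihilatesD => //; exact: annihilatesZ.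
Qed.

(** In the Leibniz expansion each permutation contributes a signed product of [n] weight transforms,
    and each factor lengthens the interval by 1. *)
Lemma annihilates_Dn n (alpha beta : R) : -1 < alpha -> -1 < beta ->
  annihilates n%:R (fun l => Dn n (- 'i%C * l%:C) alpha beta).
Proof.
move=> ha hb.
rewrite (_ : (fun l => _) = fun l => \sum_(s : 'S_n) (-1) ^+ s *
    \prod_(i < n) weight_transform `[0, 1]%classic
      (fun x => x ^+ (i + s i) * x `^ alpha * (1 - x) `^ beta) l).
  apply: annihilates_sum => s; apply: annihilates_prod => i.
  exact: integrable_jacobi_weight.
apply/funext => l; rewrite /Dn /determinant; apply: eq_bigr => s _.
congr (_ * _); apply: eq_bigr => i _; rewrite mxE.
(* The two minus signs cancel, which leaves the kernel [e^{ilx}] of [weight_transform]. *)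
have e x : cexp (- (- 'i%C * l%:C) * x%:C) = cis (l * x).
  by rewrite !mulNr opprK -mulrA -rmorphM cexp_i.
transitivity (cintegral `[0, 1]%classic (fun x : R =>
    (x ^+ (i + s i) * x `^ alpha * (1 - x) `^ beta)%:C * cis (l * x))).
  by congr cintegral; apply/funext => x; rewrite e.
by apply: complex_eqP => /=; apply: eq_Rintegral => x _;
  rewrite mul0r ?subr0 ?addr0.
Qed.

End Vanishing.

(** * Test functions: continuity estimate and support of the distribution *)

Section TestFunctions.
Local Open Scope complex_scope.
Context {R : realType}.
Local Notation mu := (@lebesgue_measure R).
Local Notation Re := (@complex.Re R).
Local Notation Im := (@complex.Im R).
Implicit Types (phi psi H : R -> R[i]) (u : R -> R) (A M l x y : R).

(** The bound [A] depends on [K] alone, as the constant in the continuity estimate must be uniform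
    over all [phi] supported in [K]. *)
Lemma test_function_C2c (K : set R) : compact K -> exists2 A : R, 0 < A &
  forall phi, test_function K phi ->
    C2c A (Re \o phi) (derive1n 1 (Re \o phi)) (derive1n 2 (Re \o phi)) /\
    C2c A (Im \o phi) (derive1n 1 (Im \o phi)) (derive1n 2 (Im \o phi)).
Proof.
move=> /compact_bounded[M [_ MK]]; exists (`|M| + 1).
  by rewrite ltr_wpDl.
move=> phi [sm _ suppK].
have phi0 x : `|M| + 1 < `|x| -> phi x = 0.
  move=> Mx; apply/eqP; apply: contraTT Mx => phix.
  rewrite -leNgt; apply: MK; first by rewrite ltr_pwDr// ler_norm.
  by apply: suppK; exact: subset_closure.
have C2 (f : R -> R) : (forall (k : nat) x, derivable (derive1n k f) x 1) ->
    (forall x, `|M| + 1 < `|x| -> f x = 0) ->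
    C2c (`|M| + 1) f (derive1n 1 f) (derive1n 2 f).
  move=> df f0.
  have d k x : is_derive x 1 (derive1n k f) (derive1n k.+1 f x).
    by rewrite derive1nS derive1E; apply: derivableP.
  split=> //; last by move=> x; exact: (d 0).
  exact: is_derive_continuous (d 2).
split; apply: C2.
- by move=> k x; have [] := sm k x.
- by move=> x /phi0 /= ->.
- by move=> k x; have [] := sm k x.
- by move=> x /phi0 /= ->.
Qed.

(** The whole line is not compact; replacing it by the support of [phi] makes [test_function_C2c]
    applicable. *)
Lemma test_function_setT phi : test_function setT phi ->
  test_function (csupport phi) phi.
Proof. by move=> [? ? _]; split. Qed.

Lemma cexp_fourier (c l : R) :
  cexp (- 'i%C * c%:C * l%:C) = cos (l * c) -i* sin (l * c).
Proof.
have -> : - 'i%C * c%:C * l%:C = 'i%C * (- (l * c))%:C :> R[i].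
  by rewrite mulNr mulNr -mulrA -rmorphM [c * l]mulrC rmorphN mulrN.
by rewrite cexp_i /cis cosN sinN.
Qed.

Section OneTestFunction.
Variables (A : R) (phi : R -> R[i]) (u1 u2 v1 v2 : R -> R).
Hypotheses (A0 : 0 < A) (uc : C2c A (Re \o phi) u1 u2)
  (vc : C2c A (Im \o phi) v1 v2).

(** This carries the results on real functions over to complex test functions. *)
Lemma fourier_uhat l :
  fourier phi l = uhat (Re \o phi) l + 'i%C * uhat (Im \o phi) l.
Proof.
have cc (y : R) : continuous (fun x : R => cos (y * x)).
  by have := @continuous_cos_affine R y 0; under eq_fun do rewrite addr0.
have cs (y : R) : continuous (fun x : R => sin (y * x)).
  by have := @continuous_sin_affine R y 0; under eq_fun do rewrite addr0.
have ruc := integrable_C2cM uc (cc l); have rus := integrable_C2cM uc (cs l).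
have ivc := integrable_C2cM vc (cc l); have ivs := integrable_C2cM vc (cs l).
rewrite /fourier; apply: complex_eqP => /=.
  rewrite mul0r mul1r opprK add0r -RintegralD//.
  by apply: eq_Rintegral => x _; rewrite cexp_fourier Re_mul/=; ring.
rewrite mul0r mul1r add0r addrC -RintegralB//.
by apply: eq_Rintegral => x _; rewrite cexp_fourier Im_mul/=; ring.
Qed.

Lemma fourierE : fourier phi =
  fun l => uhat (Re \o phi) l + 'i%C * uhat (Im \o phi) l.
Proof. by apply/funext => l; exact: fourier_uhat. Qed.

Lemma cintegrable_fourier : cintegrable (fourier phi).
Proof.
rewrite fourierE; apply: cintegrableD; first exact: cintegrable_uhat uc.
by apply: cintegrableZ; exact: cintegrable_uhat vc.
Qed.

Lemma fourier_decay M l :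
  (forall x, `|Re (phi x)| <= M) -> (forall x, `|Im (phi x)| <= M) ->
  (forall x, `|u2 x| <= M) -> (forall x, `|v2 x| <= M) ->
  `|Re (fourier phi l)| <= 8 * A * M * (oneDsqr l)^-1 /\
  `|Im (fourier phi l)| <= 8 * A * M * (oneDsqr l)^-1.
Proof.
move=> uM vM u2M v2M; rewrite fourier_uhat /=.
have d1 := transform_decay l A0 uc uM u2M oscillator_cos.
have d2 := transform_decay l A0 uc uM u2M oscillator_sin.
have d3 := transform_decay l A0 vc vM v2M oscillator_cos.
have d4 := transform_decay l A0 vc vM v2M oscillator_sin.
(* Each component combines one transform of [Re phi] and one of [Im phi], both bounded with the
   constant 4. *)
have -> : 8 * A * M * (oneDsqr l)^-1 =
  4 * A * M * (oneDsqr l)^-1 + 4 * A * M * (oneDsqr l)^-1 by ring.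
rewrite !mul0r !mul1r opprK !add0r; split.
  by rewrite (le_trans (ler_normD _ _))// lerD.
by rewrite (le_trans (ler_normD _ _))// normrN lerD.
Qed.

End OneTestFunction.

Lemma normc_le_ReIm (z : R[i]) : `|z| <= (`|Re z| + `|Im z|)%:C.
Proof.
rewrite normc_def lecR -[leRHS]ger0_norm ?addr_ge0// -sqrtr_sqr ler_wsqrtr//.
rewrite sqrrD !real_normK ?num_real// lerD2r lerDl.
by rewrite mulrn_wge0 ?mulr_ge0.
Qed.

Lemma ReIm_le_normc (z : R[i]) M : `|z| <= M%:C -> `|Re z| <= M /\ `|Im z| <= M.
Proof.
rewrite normc_def lecR => zM; split; apply: le_trans zM;
  by rewrite -sqrtr_sqr ler_wsqrtr// ?lerDl ?lerDr sqr_ge0.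
Qed.

(** Linearity of [cintegral] is available for integrable functions, so the decay of the Fourier
    transform serves in both halves. *)
Lemma is_distribution_fourier H (c : R[i]) : bounded_measurable H ->
  is_distribution (fun phi => c * fourier_distribution H phi).
Proof.
move=> bH; split.
  move=> a phi psi /test_function_setT tp /test_function_setT tq.
  have [_ cp _] := tp; have [_ cq _] := tq.
  have [A A0 /(_ _ tp)[uc vc]] := test_function_C2c cp.
  have [B B0 /(_ _ tq)[uc' vc']] := test_function_C2c cq.
  have ip := cintegrable_fourier A0 uc vc.
  have iq := cintegrable_fourier B0 uc' vc'.
  have lin : fourier (fun x => a * phi x + psi x) =
      fun l => a * fourier phi l + fourier psi l.
    have cE l x : cexp (- 'i%C * x%:C * l%:C) = cis (- l * x) :> R[i].
      by rewrite cexp_fourier mulNr /cis cosN sinN.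
    have cf f B' v1 v2 w1 w2 l : C2c B' (Re \o f) v1 v2 -> C2c B' (Im \o f) w1 w2 ->
        cintegrable (fun x => cexp (- 'i%C * x%:C * l%:C) * f x).
      move=> fc fc'; under eq_fun do rewrite cE.
      apply: cintegrableM; first exact: bounded_measurable_cis.
      have one g g1 g2 : C2c B' g g1 g2 -> mu.-integrable setT (EFin \o g).
        by move=> [_ d1 _ g0]; exact: (integrable_cpt (is_derive_continuous d1) g0).
      by split; [exact: one fc|exact: one fc'].
    have ip' l := cf _ _ _ _ _ _ l uc vc; have iq' l := cf _ _ _ _ _ _ l uc' vc'.
    apply/funext => l; rewrite /fourier -cintegralZ// -cintegralD//; last exact: cintegrableZ.
    by congr cintegral; apply/funext => x; ring.
  rewrite /fourier_distribution lin.
  have -> : (fun l => H l * (a * fourier phi l + fourier psi l)) =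
      (fun l => a * (H l * fourier phi l) + H l * fourier psi l).
    by apply/funext => l; ring.
  rewrite cintegralD; last 2 first.
  - by apply: cintegrableZ; exact: cintegrableM.
  - exact: cintegrableM.
  rewrite cintegralZ; last exact: cintegrableM.
  by rewrite mulrDr mulrCA.
move=> K /test_function_C2c[A A0 HA].
have [_ _ [B HB]] := bH.
pose J := \int[mu]_l (oneDsqr l)^-1.
have [N N0 nE] : exists2 N : R, 0 <= N & `|c| = N%:C.
  by rewrite normc_def; eexists; [|reflexivity]; exact: sqrtr_ge0.
(* Each component of [H l * fourier phi l] is a combination of two products bounded by
   [B * 8 A M / (1 + l^2)], hence 16; real and imaginary parts together give 32. The order 2 is that
   of the derivatives in [fourier_decay]. *)
exists (N * (32 * A * B * J)), 2 => phi M tp phiM.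
have [uc vc] := HA _ tp.
have B0 : 0 <= B by have [h _] := HB 0; rewrite (le_trans _ h).
have uM x : `|Re (phi x)| <= M.
  exact: (ReIm_le_normc (phiM 0 x isT)).1.
have vM x : `|Im (phi x)| <= M.
  exact: (ReIm_le_normc (phiM 0 x isT)).2.
have u2M x : `|derive1n 2 (Re \o phi) x| <= M.
  exact: (ReIm_le_normc (phiM 2 x isT)).1.
have v2M x : `|derive1n 2 (Im \o phi) x| <= M.
  exact: (ReIm_le_normc (phiM 2 x isT)).2.
have M0 : 0 <= M by rewrite (le_trans _ (uM 0)).
have [iR iI] : cintegrable (fun l => H l * fourier phi l).
  by apply: cintegrableM => //; exact: cintegrable_fourier A0 uc vc.
have bound (f : R -> R) : mu.-integrable setT (EFin \o f) ->
    (forall l, `|f l| <= 16 * A * B * M * (oneDsqr l)^-1) ->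
    `|\int[mu]_l f l| <= 16 * A * B * M * J.
  move=> fi fb; apply: (le_trans (le_normr_Rintegral measurableT fi)).
  rewrite /J -RintegralZl//; last exact: integrable_oneDsqrV.
  apply: le_Rintegral => //; first exact: integrable_norm.
  exact: (integrableZl _ _ integrable_oneDsqrV).
have dec l := fourier_decay A0 uc vc l uM vM u2M v2M.
have o0 l : 0 <= (oneDsqr l)^-1 by rewrite invr_ge0 addr_ge0 ?sqr_ge0.
have e16 l : 16 * A * B * M * (oneDsqr l)^-1 =
  B * (8 * A * M * (oneDsqr l)^-1) + B * (8 * A * M * (oneDsqr l)^-1) by ring.
have bR := bound _ iR; have bI := bound _ iI.
rewrite normrM nE -mulrA rmorphM ler_wpM2l ?ler0c//.
apply: (le_trans (normc_le_ReIm _)); rewrite lecR.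
have -> : 32 * A * B * J * M = 16 * A * B * M * J + 16 * A * B * M * J by ring.
rewrite lerD//=.
  apply: bR => l; rewrite /= Re_mul e16.
  have [h1 h2] := HB l; have [k1 k2] := dec l.
  by rewrite (le_trans (ler_normB _ _))// !normrM lerD// ler_pM.
apply: bI => l; rewrite /= Im_mul e16.
have [h1 h2] := HB l; have [k1 k2] := dec l.
by rewrite (le_trans (ler_normD _ _))// !normrM lerD// ler_pM.
Qed.

(** The complement of [[0, m]] is open, and a test function supported in it vanishes near every
    point of [[0, m]], so [annihilates] at [y = 0] applies to its real and imaginary parts. *)
Lemma dsupport_fourier (m : R) H (c : R[i]) : annihilates m H ->
  dsupport (fun phi => c * fourier_distribution H phi) `<=` `[0, m]%classic.
Proof.
move=> [bH H0] x; rewrite /dsupport/=.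
apply: contra_notP => xm.
exists (~` `[0, m]%classic) => //; split.
  by rewrite openC; exact: interval_closed.
move=> phi tp.
have [sm ck sub] := tp.
have [A A0 /(_ phi)[|uc vc]] := test_function_C2c ck; first by split.
have phi0 (t : R) : 0 <= t <= 0 + m -> \forall z \near t, phi z = 0.
  rewrite add0r => tm.
  have : (~` csupport phi) t by move=> /sub; apply; rewrite /= in_itv.
  have : open (~` csupport phi) by rewrite openC; exact: closed_closure.
  move=> o nt; have := open_nbhs_nbhs (conj o nt).
  apply: filterS => z nz; apply/eqP; apply: contra_notT nz => phiz.
  exact: subset_closure.
rewrite /fourier_distribution (fourierE uc vc).
(* The factor [cis (0 * l) = 1] is inserted to match [annihilates] at [y = 0]. *)
have -> : (fun l => H l * (uhat (Re \o phi) l + 'i%C * uhat (Im \o phi) l)) =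
  (fun l => cis (0 * l) * (H l * uhat (Re \o phi) l) +
    'i%C * (cis (0 * l) * (H l * uhat (Im \o phi) l))).
  apply/funext => l; have -> : cis (0 * l) = 1 :> R[i].
    by rewrite mul0r /cis cos0 sin0.
  by ring.
have bc := @bounded_measurable_cis R 0.
have iu : cintegrable (fun l => cis (0 * l) * (H l * uhat (Re \o phi) l)).
  by apply: cintegrableM => //; apply: cintegrableM => //; exact: cintegrable_uhat uc.
have iv : cintegrable (fun l => cis (0 * l) * (H l * uhat (Im \o phi) l)).
  by apply: cintegrableM => //; apply: cintegrableM => //; exact: cintegrable_uhat vc.
rewrite cintegralD//; last exact: cintegrableZ.
rewrite cintegralZ// (H0 _ _ _ _ _ A0 uc); last first.
  by move=> t /phi0; apply: filterS => z /= ->.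
rewrite (H0 _ _ _ _ _ A0 vc); last first.
  by move=> t /phi0; apply: filterS => z /= ->.
by rewrite mulr0 addr0 mulr0.
Qed.

End TestFunctions.

Unset Implicit Arguments.

Theorem lemma7p1 (R : realType) (alpha beta : R) (n : nat)
    (halpha : -1 < alpha) (hbeta : -1 < beta) (hn : (1 <= n)%N) :
  is_distribution (jacobiP alpha beta n) /\
  dsupport (jacobiP alpha beta n) `<=` `[0, n%:R]%classic.
Proof.
have aD := annihilates_Dn n halpha hbeta.
(* [jacobiP] is by definition a constant times [fourier_distribution], the form treated by both
   general lemmas. *)
split; first by apply: is_distribution_fourier; case: aD.
exact: dsupport_fourier aD.
Qed.
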